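(* Let $1\le s,q,r<\infty$ with $q<s$ and $r\le s$. A Banach space $X$ has finite dimension if and only if $\ell_{(s,q,r)}^{A}(X)=\ell_q(X)$.
   Context: Banach spaces are over $\mathbb{K}=\mathbb{R}$ or $\mathbb{C}$; $X^*$ is the topological dual of $X$. $\ell_p(X)$ is the space of absolutely $p$-summable $X$-valued sequences. The space $\ell^{A}_{(s,q,r)}(X)$ of anisotropic $(s,q,r)$-summable sequences consists of all sequences $(x_j)_{j=1}^\infty$ in $X$ such that $\sum_{j=1}^\infty\left(\sum_{k=1}^\infty|x_k^*(x_j)|^s\right)^{q/s}<\infty$ for every $(x_k^* )_{k=1}^\infty\in\ell_r(X^* )$. *)

(* Defs.v *)
From mathcomp Require Import all_boot all_order all_algebra.
From mathcomp Require Import complex.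
From mathcomp Require Import all_classical all_reals all_analysis.

Set Implicit Arguments.
Unset Strict Implicit.
Unset Printing Implicit Defensive.

Import Order.TTheory GRing.Theory Num.Theory.
Import numFieldNormedType.Exports.

Local Open Scope classical_set_scope.
Local Open Scope ring_scope.

Inductive scalar_kind := RealScalars | ComplexScalars.

Definition scalars (R : realType) (k : scalar_kind) : numFieldType :=
  match k with
  | RealScalars => R
  | ComplexScalars => R[i]
  end.

Definition re_scalar (R : realType) (k : scalar_kind) : scalars R k -> R :=
  match k return scalars R k -> R with
  | RealScalars => fun x => x
  | ComplexScalars => fun z => complex.Re z
  end.

(* The norm of a normedModType over K takes its values in K, as nonnegative
   real elements; here it is read as a real number. *)
Definition rnorm (R : realType) (k : scalar_kind)
    (X : normedModType (scalars R k)) (x : X) : R :=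
  re_scalar `|x|.

Record dual (K : numFieldType) (X : normedModType K) := Dual {
  dual_fun :> {linear X -> K^o};
  dual_continuous : continuous dual_fun }.

Section SequenceSpaces.
Context {R : realType} {k : scalar_kind}.
Local Notation K := (scalars R k).
Implicit Types (X : normedModType K) (s q r p : R).

(* The set is nonempty and, f being continuous, bounded: sup is not used at
   its default value. *)
Definition dual_norm X (f : dual X) : R :=
  sup [set rnorm (f x) | x in [set x : X | rnorm x <= 1]].

Definition abs_summable p (u : nat -> R) : Prop :=
  (\sum_(0 <= j <oo) (u j `^ p)%:E < +oo)%E.

Definition lp p X : set (nat -> X) :=
  [set x | abs_summable p (fun j => rnorm (x j))].

Definition lp_dual p X : set (nat -> dual X) :=
  [set f | abs_summable p (fun j => dual_norm (f j))].

(* The inner sums are taken in the extended reals: an infinite inner sum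
   makes the outer one infinite, as +oo `^ (q / s) = +oo. *)
Definition lA s q r X : set (nat -> X) :=
  [set x | forall f : nat -> dual X, lp_dual r f ->
    (\sum_(0 <= j <oo)
       (\sum_(0 <= i <oo) (rnorm (f i (x j)) `^ s)%:E) `^ (q / s) < +oo)%E].

Definition finite_dimensional X : Prop :=
  exists (n : nat) (e : 'I_n -> X),
    forall x : X, exists c : 'I_n -> K, x = \sum_(i < n) c i *: e i.

End SequenceSpaces.

Arguments lp {R k} p X.
Arguments lp_dual {R k} p X.
Arguments lA {R k} s q r X.
Arguments finite_dimensional {R k} X.

(* Main.v *)
(* If X has finite dimension, a finite family of coordinate functionals already
   controls the norm, which gives lA <= lp; the converse inclusion holds in every
   X because the norms of the f_i are s-summable (r <= s).

   If X has infinite dimension, every k admits vectors y_1, ..., y_k of norm at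
   least 1/16 with |sum a_i y_i| <= |a|_2 for real a (a weak form of the
   Dvoretzky-Rogers lemma).  Testing with signs gives
   sum_i |f(y_i)|^s <= 2 |f|^s sqrt k, so that T(y) := sum_i |f_i(y)|^s satisfies
   sum_j T(y_j)^(q/s) = O(k^(1 - q/(2s))), whereas sum_j |y_j|^q >= k / 16^q.
   Concatenating such blocks for k = 2^m, scaled by k^(-1/q), yields a sequence in
   lA whose q-th powers sum to infinity.

   The Dvoretzky-Rogers vectors are found among matrices U of size 2k with
   |aU| <= |a|_2 whose determinant is within a factor 2 of the supremum.  If all
   unit a supported on the last 2k - j > k coordinates had |aU| < 1/16, multiplying
   these rows by 8 and the others by 1/2 would increase the determinant by a factor
   at least 4^k.  A Householder reflection turns a unit a with |aU| >= 1/16 into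
   the j-th coordinate vector, leaving the previous rows unchanged. *)
From HB Require Import structures.
Require Import Defs.
From mathcomp Require Import all_boot all_order all_algebra.
From mathcomp Require Import perm complex ring lra.
From mathcomp Require Import all_classical all_reals all_analysis.

Set Implicit Arguments.
Unset Strict Implicit.
Unset Printing Implicit Defensive.

Import Order.TTheory GRing.Theory Num.Def Num.Theory.
Import numFieldNormedType.Exports.

Local Open Scope classical_set_scope.
Local Open Scope ring_scope.

(** * Euclidean norm of rows and orthogonal matrices *)

Section Euclidean.
Context {R : realType} {n : nat}.
Implicit Types (a w : 'rV[R]_n) (G : 'M[R]_n).

Definition enorm a : R := Num.sqrt (\sum_i a 0 i ^+ 2).

Lemma enorm_trmx a : enorm a = Num.sqrt ((a *m a^T) 0 0).
Proof.
by rewrite /enorm mxE; congr Num.sqrt; apply: eq_bigr => i _; rewrite mxE expr2.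
Qed.

Lemma enorm_ge0 a : 0 <= enorm a. Proof. exact: sqrtr_ge0. Qed.

Lemma enormZ (c : R) a : enorm (c *: a) = `|c| * enorm a.
Proof.
rewrite /enorm; under eq_bigr do rewrite mxE exprMn.
by rewrite -mulr_sumr sqrtrM ?sqr_ge0 // sqrtr_sqr.
Qed.

Lemma enorm_eq0 a : enorm a = 0 -> a = 0.
Proof.
move=> /eqP; rewrite sqrtr_eq0 => h; apply/rowP => i; rewrite mxE.
apply/eqP; rewrite -sqrf_eq0; apply/eqP/le_anti; rewrite sqr_ge0 andbT.
apply: le_trans h; rewrite (bigD1 i) //= lerDl.
by apply: sumr_ge0 => *; exact: sqr_ge0.
Qed.

Lemma le_enorm a w : (forall i, `|a 0 i| <= `|w 0 i|) -> enorm a <= enorm w.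
Proof.
move=> h; apply: ler_wsqrtr; apply: ler_sum => i _.
by rewrite -[a 0 i ^+ 2]real_normK ?num_real // -[w 0 i ^+ 2]real_normK ?num_real //
   ler_pXn2r ?nnegrE.
Qed.

Lemma enorm_orth a G : G *m G^T = 1%:M -> enorm (a *m G) = enorm a.
Proof. by move=> h; rewrite !enorm_trmx trmx_mul mulmxA -(mulmxA a) h mulmx1. Qed.

(* A Householder reflection in the hyperplane orthogonal to [a - delta_j]. *)
Lemma orth_extend (j : 'I_n) a : enorm a = 1 ->
    (forall i : 'I_n, (i < j)%N -> a 0 i = 0) ->
  exists G, [/\ G *m G^T = 1%:M, row j G = a &
    forall i : 'I_n, (i < j)%N -> row i G = delta_mx 0 i].
Proof.
(* When [a] is already the [j]-th coordinate vector there is no hyperplane to reflect in, and the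
   identity serves. *)
move=> a1 a0; have [aj|aj] := eqVneq a (delta_mx 0 j).
  exists 1%:M; split; first by rewrite trmx1 mulmx1.
    by rewrite aj rowE mulmx1.
  by move=> i _; rewrite rowE mulmx1.
pose w := a - delta_mx 0 j.
have aa : (a *m a^T) 0 0 = 1.
  have := a1; rewrite enorm_trmx => h; rewrite -[LHS]sqr_sqrtr ?h ?expr1n //.
  by rewrite mxE; apply: sumr_ge0 => i _; rewrite mxE -expr2 sqr_ge0.
have ad : (a *m (delta_mx 0 j : 'rV[R]_n)^T) 0 0 = a 0 j.
  rewrite mxE (bigD1 j) //= big1 ?addr0 ?mxE ?eqxx ?mulr1 // => i ij.
  by rewrite !mxE (negbTE ij) andbF mulr0.
have da i : ((delta_mx 0 i : 'rV[R]_n) *m a^T) 0 0 = a 0 i.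
  by rewrite -rowE !mxE.
have dd i : ((delta_mx 0 i : 'rV[R]_n) *m (delta_mx 0 j : 'rV[R]_n)^T) 0 0 = (i == j)%:R.
  by rewrite -rowE !mxE eqxx.
pose d := (w *m w^T) 0 0.
have dE : d = 2 - a 0 j *+ 2.
  rewrite /d /w linearB /= mulmxBl !mulmxBr !mxE.
  have -> : \sum_j0 a 0 j0 * a^T j0 0 = 1 by rewrite -aa mxE.
  have -> : \sum_j0 a 0 j0 * (delta_mx 0 j : 'rV[R]_n)^T j0 0 = a 0 j by rewrite -ad mxE.
  have -> : \sum_j0 (delta_mx 0 j : 'rV[R]_n) 0 j0 * a^T j0 0 = a 0 j.
    by rewrite -(da j) mxE.
  have -> : \sum_j0 (delta_mx 0 j : 'rV[R]_n) 0 j0 * (delta_mx 0 j : 'rV[R]_n)^T j0 0 = 1.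
    by have := dd j; rewrite mxE eqxx.
  by rewrite mulr2n; ring.
have d0 : d != 0.
  apply/eqP => d0; move/eqP: aj; apply; apply/eqP; rewrite -subr_eq0; apply/eqP.
  by apply: enorm_eq0; rewrite enorm_trmx -/d d0 sqrtr0.
(* Here [d] is the squared length of [w], so [G] is the reflection along [w]: it is symmetric, and
   orthogonality reduces to [G *m G = 1%:M]. *)
pose G : 'M[R]_n := 1%:M - (2 / d) *: (w^T *m w).
have wwww : w^T *m w *m (w^T *m w) = d *: (w^T *m w).
  rewrite mulmxA -(mulmxA w^T) [w *m w^T]mx11_scalar -/d.
  by rewrite mul_mx_scalar -scalemxAl.
have Gsym : G^T = G.
  by rewrite /G linearB /= trmx1 linearZ /= trmx_mul trmxK.
have rowG i : row i G = delta_mx 0 i - (2 / d * w 0 i) *: w.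
  rewrite rowE /G mulmxBr mulmx1 -scalemxAr mulmxA; congr (_ - _).
  rewrite -scalerA; congr (_ *: _).
  by rewrite [X in X *m _]mx11_scalar -rowE mul_scalar_mx !mxE.
exists G; split.
- rewrite Gsym {2}/G mulmxBr mulmx1 {1}/G mulmxBl mul1mx.
  rewrite -scalemxAl -scalemxAr scalerA wwww.
  rewrite scalerA opprB.
  have -> : 2 / d * (2 / d) * d = 2 / d + 2 / d by field.
  by rewrite scalerDl addrK subrK.
- rewrite rowG.
  (* As [d = 2 - 2 * a 0 j] and [w 0 j = a 0 j - 1], row [j] of [G] becomes [delta_mx 0 j + w], that
     is, [a]. *)
  have -> : 2 / d * w 0 j = -1.
    rewrite !mxE !eqxx /= -[X in 2 / X]/d dE; move: d0; rewrite dE => d0.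
    have d0' : a 0 j - 1 != 0.
      by apply: contraNneq d0; rewrite mulr2n => h; apply/eqP; lra.
    apply: (mulfI d0); rewrite mulrA mulrCA divff // mulr2n; ring.
  by rewrite scaleN1r opprK /w addrC subrK.
- move=> i ij; rewrite rowG.
  have -> : w 0 i = 0.
    rewrite !mxE a0 // eqxx /= -[i == j]/(i == j :> nat) ltn_eqF // subr0 //.
  by rewrite mulr0 scale0r subr0.
Qed.

End Euclidean.

(** * Contractive matrices with nearly maximal determinant *)

Section NormOnRows.
Context {R : realType}.

Section SubNorm.
Context {n : nat} (N : 'rV[R]_n -> R).
Context (ND : forall u v, N (u + v) <= N u + N v).
Context (NZ : forall c u, N (c *: u) = `|c| * N u).

Lemma seminorm0 : N 0 = 0.
Proof. by rewrite -(scale0r 0) NZ normr0 mul0r. Qed.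

Lemma seminorm_ge0 v : 0 <= N v.
Proof.
have := ND v (- v); rewrite subrr seminorm0 -scaleN1r NZ normrN normr1 mul1r.
by move=> h; lra.
Qed.

Lemma seminorm_sum (I : Type) (r : seq I) (F : I -> 'rV[R]_n) :
  N (\sum_(i <- r) F i) <= \sum_(i <- r) N (F i).
Proof.
elim: r => [|i r IH]; first by rewrite !big_nil seminorm0.
by rewrite !big_cons; apply: le_trans (ND _ _) _; rewrite lerD2l.
Qed.

(** Expand [v] in coordinate vectors. The summand 1 in the constant keeps it positive even when [N]
    vanishes. *)
Lemma seminorm_bounded : exists2 B, 0 < B & forall v, N v <= B * enorm v.
Proof.
exists (1 + \sum_i N (delta_mx 0 i)).
  by rewrite ltr_wpDr // sumr_ge0 // => i _; exact: seminorm_ge0.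
move=> v; rewrite {1}[v]row_sum_delta; apply: le_trans (seminorm_sum _ _) _.
rewrite mulrDl mul1r; apply: ler_wpDl; first exact: enorm_ge0.
rewrite mulr_suml; apply: ler_sum => i _; rewrite NZ mulrC.
apply: ler_wpM2l; first exact: seminorm_ge0.
rewrite /enorm -sqrtr_sqr; apply: ler_wsqrtr; rewrite (bigD1 i) //= lerDl.
by apply: sumr_ge0 => *; exact: sqr_ge0.
Qed.

(** Since [a *m U] combines the rows of [U] with coefficients [a], this is a bound of weak
    2-summability type on the rows of [U]. *)
Definition contractive (U : 'M[R]_n) := forall a, N (a *m U) <= enorm a.

Lemma contractive_orth (G U : 'M[R]_n) :
  G *m G^T = 1%:M -> contractive U -> contractive (G *m U).
Proof.
move=> hG hU a; rewrite mulmxA; apply: le_trans (hU _) _.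
by rewrite enorm_orth.
Qed.

Context (Nnd : exists2 e, 0 < e & forall (v : 'rV[R]_(_)) i, e * `|v 0 i| <= N v).

(** The determinants of contractive matrices are bounded, because the entries are, and a small
    multiple of the identity makes their supremum positive. A factor 2 suffices later, so the
    supremum need not be attained. *)
Lemma contractive_det_max : exists U, [/\ contractive U, 0 < `|\det U| &
  forall V, contractive V -> `|\det V| <= 2 * `|\det U|].
Proof.
have [e e0 eN] := Nnd.
pose D : set R := [set `|\det U| | U in [set U | contractive U]]%classic.
have [B B0 BN] := seminorm_bounded.
have DB : D (`|\det ((B^-1)%:M : 'M[R]_n)|).
  exists (B^-1)%:M => // a /=; rewrite mul_mx_scalar NZ gtr0_norm ?invr_gt0 //.
  by rewrite mulrC ler_pdivrMr // mulrC.
have supD : has_sup D.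
  split; first by exists (`|\det ((B^-1)%:M : 'M[R]_n)|).
  (* Leibniz formula: row [i] of [U] is the image of a coordinate vector, so its [N]-norm is at most
     1 and its entries are at most [e^-1]. *)
  exists (\sum_(s : {perm 'I_n}) \prod_(i < n) e^-1) => _ [U hU <-].
  rewrite /determinant; apply: le_trans (ler_norm_sum _ _ _) _.
  apply: ler_sum => s _; rewrite normrM normrX normrN normr1 expr1n mul1r.
  rewrite normr_prod; apply: ler_prod => i _; rewrite normr_ge0 /=.
  rewrite -[leRHS]mul1r ler_pdivlMr // mulrC.
  have := eN (row i U) (s i); rewrite mxE; move/le_trans; apply.
  rewrite rowE; apply: le_trans (hU _) _.
  rewrite /enorm (bigD1 i) //= big1 ?addr0 ?mxE ?eqxx ?expr1n ?sqrtr1 //.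
  by move=> j ji; rewrite mxE (negbTE ji) andbF expr0n.
have det0 : 0 < `|\det ((B^-1)%:M : 'M[R]_n)|.
  by rewrite det_scalar normrX exprn_gt0 // normr_gt0 invr_eq0 gt_eqF.
have sup0 : 0 < sup D.
  by apply: lt_le_trans det0 _; exact: ub_le_sup supD.2 _ DB.
have sup20 : 0 < sup D / 2 by rewrite divr_gt0.
have [_ [U hU <-] hlt] := sup_adherent sup20 supD.
exists U; split => //; first by apply: le_lt_trans hlt; lra.
move=> V hV; have : `|\det V| <= sup D by apply: ub_le_sup supD.2 _ _; exists V.
by move=> h; lra.
Qed.

End SubNorm.

Context {k : nat} (N : 'rV[R]_(k + k) -> R).
Context (ND : forall u v, N (u + v) <= N u + N v).
Context (NZ : forall c u, N (c *: u) = `|c| * N u).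
Context (Nnd : exists2 e, 0 < e & forall (v : 'rV[R]_(_)) i, e * `|v 0 i| <= N v).

Lemma contractive_tail_vector (U : 'M[R]_(k + k)) (j : 'I_(k + k)) :
  (j < k)%N -> contractive N U -> 0 < `|\det U| ->
  (forall V, contractive N V -> `|\det V| <= 2 * `|\det U|) ->
  exists a, [/\ enorm a = 1, (forall i : 'I_(k + k), (i < j)%N -> a 0 i = 0) &
    16^-1 <= N (a *m U)].
Proof.
move=> jk hU dU0 dmax; apply: contrapT => hn.
(* By homogeneity, the assumed failure on unit vectors extends to every vector supported on the
   indices from [j] on. *)
have small (a : 'rV[R]_(k + k)) : (forall i : 'I_(k + k), (i < j)%N -> a 0 i = 0) ->
    N (a *m U) <= 16^-1 * enorm a.
  move=> a0; have [ea|ea] := eqVneq (enorm a) 0.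
    by rewrite (enorm_eq0 ea) mul0mx (seminorm0 NZ) mulr_ge0 ?enorm_ge0.
  have ep : 0 < enorm a by rewrite lt_neqAle eq_sym ea enorm_ge0.
  rewrite leNgt; apply/negP => h; apply: hn; exists ((enorm a)^-1 *: a); split.
  - by rewrite enormZ normfV gtr0_norm // mulVf.
  - by move=> i /a0 a0i; rewrite mxE a0i mulr0.
  - rewrite -scalemxAl NZ normfV gtr0_norm // mulrC ler_pdivlMr //; exact: ltW.
pose d : 'rV[R]_(k + k) := \row_i (if (i < j)%N then 2^-1 else 8).
have : contractive N (diag_mx d *m U).
  (* Splitting [a] into head and tail gives 1/2 from the head and 8/16 from the tail, together
     exactly the factor 1. *)
  move=> a; pose a1 : 'rV[R]_(k + k) := \row_i (if (i < j)%N then a 0 i else 0).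
  pose a2 : 'rV[R]_(k + k) := \row_i (if (i < j)%N then 0 else a 0 i).
  have -> : a *m (diag_mx d *m U) = 2^-1 *: (a1 *m U) + 8 *: (a2 *m U).
    rewrite mulmxA !scalemxAl -mulmxDl; congr (_ *m _).
    apply/rowP => i; rewrite mul_mx_diag !mxE; case: ifP => _.
      by rewrite mulr0 addr0 mulrC.
    by rewrite mulr0 add0r mulrC.
  apply: le_trans (ND _ _) _; rewrite !NZ.
  have h1 : N (a1 *m U) <= enorm a.
    apply: le_trans (hU _) _; apply: le_enorm => i; rewrite mxE.
    by case: ifP => // _; rewrite normr0.
  have h2 : N (a2 *m U) <= 16^-1 * enorm a.
    apply: le_trans (small _ _) _; first by move=> i ij; rewrite mxE ij.
    rewrite ler_wpM2l ?invr_ge0 //; apply: le_enorm => i; rewrite mxE.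
    by case: ifP => // _; rewrite normr0.
  rewrite !ger0_norm ?invr_ge0 //; lra.
move/dmax; rewrite det_mulmx normrM ler_pM2r // det_diag normr_prod big_split_ord /=.
apply/negP; rewrite -ltNge.
(* The first [k] entries of [d] are at least 1/2; the last [k] have index at least [k > j] and equal
   8. *)
have h1 : (2^-1) ^+ k <= \prod_(i < k) `|d 0 (lshift k i)|.
  rewrite -[k in _ ^+ k]card_ord -prodr_const; apply: ler_prod => i _.
  rewrite invr_ge0 ler0n /= mxE; case: ifP => _; rewrite ger0_norm ?invr_ge0 //.
  by lra.
have h2 : 8 ^+ k <= \prod_(i < k) `|d 0 (rshift k i)|.
  rewrite -[k in _ ^+ k]card_ord -prodr_const; apply: ler_prod => i _.
  rewrite ler0n /= mxE ltnNge (leq_trans (ltnW jk)) ?leq_addr //=.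
  by rewrite ger0_norm.
apply: (@lt_le_trans _ _ ((2^-1) ^+ k * 8 ^+ k)); last first.
  by apply: ler_pM => //; rewrite exprn_ge0 ?invr_ge0.
rewrite -exprMn; have -> : 2^-1 * 8 = 4 :> R by lra.
(* The growth factor [4 ^+ k] exceeds the permitted factor 2 only for positive [k], which follows
   from [j < k]. *)
have k0 : (0 < k)%N by exact: leq_ltn_trans jk.
rewrite -(prednK k0) exprS; have : 1 <= (4 : R) ^+ k.-1 by rewrite exprn_ege1 // ler1n.
by move=> h; lra.
Qed.

Lemma dvoretzky_rogers_rows : exists U : 'M[R]_(k + k), contractive N U /\
  forall i : 'I_(k + k), (i < k)%N -> 16^-1 <= N (row i U).
Proof.
(* Induction on the number of good rows. Near-maximality of the determinant is part of the
   invariant: it survives multiplication by an orthogonal matrix and supplies the next tail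
   vector. *)
suff H j : (j <= k)%N -> exists U : 'M[R]_(k + k), [/\ contractive N U, 0 < `|\det U|,
    (forall V, contractive N V -> `|\det V| <= 2 * `|\det U|) &
    forall i : 'I_(k + k), (i < j)%N -> 16^-1 <= N (row i U)].
  by have [U [hU _ _ h]] := H k (leqnn k); exists U.
elim: j => [_|j IH jk].
  by have [U [hU h0 hmax]] := contractive_det_max ND NZ Nnd; exists U; split.
have [U [hU dU0 dmax good]] := IH (ltnW jk).
have jkk : (j < k + k)%N by rewrite (leq_trans jk) // leq_addr.
have [a [a1 a0 aU]] := @contractive_tail_vector U (Ordinal jkk) jk hU dU0 dmax.
have [G [GG rowj rowi]] := orth_extend a1 a0.
have dG : `|\det G| = 1.
  have /(congr1 determinant) := GG; rewrite det_mulmx det_tr det1 => /(congr1 Num.norm).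
  rewrite normrM normr1 -expr2 => /eqP; rewrite sqrf_eq1 => /orP[/eqP //|/eqP h].
  by have := normr_ge0 (\det G); rewrite h lerNr oppr0 ler10.
exists (G *m U); split.
- exact: contractive_orth.
- by rewrite det_mulmx normrM dG mul1r.
- by move=> V hV; rewrite det_mulmx normrM dG mul1r; exact: dmax.
move=> i; rewrite ltnS leq_eqVlt => /orP[/eqP ij|ij].
  have -> : i = Ordinal jkk by apply: val_inj.
  by rewrite row_mul rowj.
by rewrite row_mul rowi // -rowE; exact: good.
Qed.

End NormOnRows.

(** * Norms on real rows dominate the coordinates *)

Lemma ler_coord_mx_norm (R : realType) n (v : 'rV[R]_n) i : `|v 0 i| <= `|v|.
Proof.
by rewrite [leRHS]/normr /= mx_normrE; apply/bigmax_geP; right => /=; exists (0, i).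
Qed.

(** [N] is Lipschitz for the max norm, hence attains a minimum on the compact unit sphere;
    definiteness makes this minimum positive. *)
Lemma rV_norm_lower_bound (R : realType) n (N : 'rV[R]_n -> R) :
  (forall u v, N (u + v) <= N u + N v) ->
  (forall c u, N (c *: u) = `|c| * N u) ->
  (forall v, N v = 0 -> v = 0) ->
  exists2 e, 0 < e & forall (v : 'rV[R]_n) i, e * `|v 0 i| <= N v.
Proof.
move=> ND NZ N0.
pose B := 1 + \sum_i N (delta_mx 0 i).
have B0 : 0 < B by rewrite ltr_wpDr // sumr_ge0 // => i _; exact: seminorm_ge0 ND NZ _.
have NB v : N v <= B * `|v|.
  rewrite {1}[v]row_sum_delta; apply: le_trans (seminorm_sum ND NZ _ _) _.
  rewrite mulrDl mul1r; apply: ler_wpDl => //.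
  rewrite mulr_suml; apply: ler_sum => i _; rewrite NZ mulrC.
  by apply: ler_wpM2l; [exact: seminorm_ge0 ND NZ _ | exact: ler_coord_mx_norm].
have NN v : N (- v) = N v by rewrite -scaleN1r NZ normrN1 mul1r.
have cN : continuous N.
  move=> v; apply/(@cvgrPdist_lt _ _ _ (nbhs v)) => e e0; near=> w.
  have Nvw : N v - N w <= N (v - w).
    by have := ND (v - w) w; rewrite subrK => h; lra.
  have Nwv : N w - N v <= N (v - w).
    by have := ND (w - v) v; rewrite subrK -opprB NN => h; lra.
  apply: (@le_lt_trans _ _ (B * `|v - w|)).
    by apply: le_trans (NB _); rewrite ler_norml; apply/andP; split; lra.
  rewrite mulrC -ltr_pdivlMr //.
  by near: w; apply: (@cvgr_dist_lt _ _ _ (nbhs v)); rewrite // divr_gt0.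
pose A : set 'rV[R]_n := [set v | `|v| = 1].
(* The sphere is empty only if every row is 0; then any constant works. *)
have [A0|A0] := pselect (A !=set0); last first.
  exists 1 => // v i; rewrite mul1r.
  have [->|v0] := eqVneq v 0; first by rewrite mxE normr0 (seminorm_ge0 ND NZ).
  exfalso; apply: A0; exists (`|v|^-1 *: v) => /=.
  by rewrite /A /= normrZ normfV normr_id mulVf // normr_eq0.
have cA : compact A.
  apply: bounded_closed_compact.
    exists 1; split; first exact: num_real.
    by move=> M M1 v /= ->; exact: ltW.
  rewrite (_ : A = (@normr _ 'rV[R]_n) @^-1` [set x : R | x = 1]) //.
  apply: closed_comp; last exact: closed_eq.
  by move=> v _; exact: norm_continuous.
have [c] := EVT_min_rV A0 cA (continuous_subspaceT cN).
rewrite inE /A /= => c1 cmin.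
have c0 : c != 0 by rewrite -normr_eq0 c1 oner_eq0.
have Nc : 0 < N c.
  rewrite lt_neqAle (seminorm_ge0 ND NZ) andbT eq_sym.
  by apply: contraNneq c0 => /N0 ->.
exists (N c) => // v i; have [->|v0] := eqVneq v 0.
  by rewrite mxE normr0 mulr0 (seminorm_ge0 ND NZ).
apply: le_trans (ler_wpM2l (ltW Nc) (ler_coord_mx_norm v i)) _.
have nv : 0 < `|v| by rewrite normr_gt0.
rewrite -ler_pdivlMr // mulrC -[`|v|^-1]gtr0_norm ?invr_gt0 // -NZ.
apply: cmin; rewrite inE /A /= normrZ gtr0_norm ?invr_gt0 // mulVf //.
by rewrite gt_eqF.
Unshelve. all: by end_near. Qed.

(** * Real and imaginary parts and real-valued norms, for both scalar fields at once *)

Definition of_real (R : realType) (k : scalar_kind) : R -> scalars R k :=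
  match k return R -> scalars R k with
  | RealScalars => fun x => x
  | ComplexScalars => fun x => real_complex R x
  end.

Definition im_scalar (R : realType) (k : scalar_kind) : scalars R k -> R :=
  match k return scalars R k -> R with
  | RealScalars => fun=> 0
  | ComplexScalars => fun z => complex.Im z
  end.

Section Scalars.
Context {R : realType} {k : scalar_kind}.
Local Notation K := (scalars R k).
Implicit Types (a b : K) (x y : R).

Lemma of_realD x y : of_real k (x + y) = of_real k x + of_real k y.
Proof. by case: k => //=; exact: rmorphD. Qed.

Lemma of_realM x y : of_real k (x * y) = of_real k x * of_real k y.
Proof. by case: k => //=; exact: rmorphM. Qed.

Lemma of_real0 : of_real k 0 = 0 :> K.
Proof. by case: k. Qed.

Lemma re_scalarD a b : re_scalar (a + b) = re_scalar a + re_scalar b.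
Proof. by case: k a b => //= -[? ?] [? ?]. Qed.

Lemma im_scalarD a b : im_scalar (a + b) = im_scalar a + im_scalar b.
Proof. by case: k a b => /= [*|[? ?] [? ?] //]; rewrite addr0. Qed.

Lemma re_scalar_of_realM x a : re_scalar (of_real k x * a) = x * re_scalar a.
Proof. by case: k a => //= -[? ?] /=; rewrite mul0r subr0. Qed.

Lemma im_scalar_of_realM x a : im_scalar (of_real k x * a) = x * im_scalar a.
Proof. by case: k a => /= [*|[? ?] /=]; rewrite ?mulr0 // mul0r addr0. Qed.

Lemma re_scalar0 : re_scalar (0 : K) = 0.
Proof. by case: k. Qed.

Lemma im_scalar0 : im_scalar (0 : K) = 0.
Proof. by case: k. Qed.

Lemma norm_of_real x : `|of_real k x| = of_real k `|x| :> K.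
Proof. by case: k => //=; rewrite normc_def /= expr0n addr0 sqrtr_sqr. Qed.

Lemma re_scalarK a : 0 <= a -> of_real k (re_scalar a) = a.
Proof.
case: k a => //= a a0; have /ger0_Im := a0.
by case: a {a0} => x y /= ->.
Qed.

Lemma ler_re_scalar a b : a <= b -> re_scalar a <= re_scalar b.
Proof. by case: k a b => //= a b; rewrite lecE => /andP[]. Qed.

Lemma ler_of_real x y : (of_real k x <= of_real k y) = (x <= y).
Proof. by case: k => //=; rewrite lecR. Qed.

Lemma re_of_real x : re_scalar (of_real k x) = x.
Proof. by case: k. Qed.

Lemma of_real_rnorm (X : normedModType K) (u : X) : of_real k (rnorm u) = `|u|.
Proof. exact: re_scalarK. Qed.

Lemma rnorm_ge0 (X : normedModType K) (u : X) : 0 <= rnorm u.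
Proof. by rewrite -re_scalar0; exact: ler_re_scalar. Qed.

Lemma rnormD (X : normedModType K) (u v : X) : rnorm (u + v) <= rnorm u + rnorm v.
Proof. by rewrite -re_scalarD; apply: ler_re_scalar; exact: ler_normD. Qed.

Lemma rnorm0 (X : normedModType K) : rnorm (0 : X) = 0.
Proof. by rewrite /rnorm normr0 re_scalar0. Qed.

Lemma rnorm_eq0 (X : normedModType K) (u : X) : rnorm u = 0 -> u = 0.
Proof. by move=> u0; apply/normr0_eq0; rewrite -of_real_rnorm u0 of_real0. Qed.

Lemma rnormZ (X : normedModType K) a (u : X) :
  rnorm (a *: u) = rnorm (a : K^o) * rnorm u.
Proof.
by rewrite {1}/rnorm normrZ -(re_scalarK (normr_ge0 a)) re_scalar_of_realM.
Qed.

Lemma rnorm_of_realZ (X : normedModType K) x (u : X) :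
  rnorm (of_real k x *: u) = `|x| * rnorm u.
Proof. by rewrite rnormZ {1}/rnorm norm_of_real re_of_real. Qed.

Lemma rnorm_sum (X : normedModType K) (I : Type) (r : seq I) (F : I -> X) :
  rnorm (\sum_(i <- r) F i) <= \sum_(i <- r) rnorm (F i).
Proof.
elim: r => [|i r IH]; first by rewrite !big_nil rnorm0.
by rewrite !big_cons; apply: le_trans (rnormD _ _) _; rewrite lerD2l.
Qed.

Lemma normr_re_le_rnorm a : `|re_scalar a| <= rnorm (a : K^o).
Proof.
rewrite /rnorm; case: k a => //= -[x y] /=; rewrite -sqrtr_sqr.
by apply: ler_wsqrtr; rewrite lerDl sqr_ge0.
Qed.

Lemma normr_im_le_rnorm a : `|im_scalar a| <= rnorm (a : K^o).
Proof.
rewrite /rnorm; case: k a => /= [x|[x y] /=]; first by rewrite normr0.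
rewrite -sqrtr_sqr.
by apply: ler_wsqrtr; rewrite lerDr sqr_ge0.
Qed.

Lemma rnorm_le_re_im a : rnorm (a : K^o) <= `|re_scalar a| + `|im_scalar a|.
Proof.
rewrite /rnorm; case: k a => /= [x|[x y] /=]; first by rewrite normr0 addr0.
rewrite -[leRHS]ger0_norm ?addr_ge0 // -[leRHS]sqrtr_sqr.
apply: ler_wsqrtr; rewrite sqrrD !real_normK ?num_real // -addrA lerD2l lerDr.
by rewrite mulrn_wge0 // mulr_ge0.
Qed.

End Scalars.

(** * Independent families, bases and coordinate bounds *)

Section Families.
Context {R : realType} {k : scalar_kind}.
Local Notation K := (scalars R k).

Definition independent (X : normedModType K) n (e : 'I_n -> X) :=
  forall c : 'I_n -> K, \sum_(i < n) c i *: e i = 0 -> forall i, c i = 0.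

(** A finite family never spans an infinite-dimensional space, so a vector outside its span can be
    put in front of it. *)
Lemma independent_exists (X : normedModType K) n :
  ~ finite_dimensional X -> exists e : 'I_n -> X, independent e.
Proof.
move=> infX; elim: n => [|n [e ind]]; first by exists (fun=> 0) => c _ [].
have [x hx] : exists x, forall c : 'I_n -> K, x <> \sum_(i < n) c i *: e i.
  apply: contrapT => h; apply: infX; exists n, e => x; apply: contrapT => hx.
  by apply: h; exists x => c xc; apply: hx; exists c.
exists (fun i => if unlift ord0 i is Some j then e j else x) => c.
rewrite big_ord_recl unlift_none; under eq_bigr do rewrite liftK.
move=> c0; have c00 : c ord0 = 0.
  apply/eqP; apply: contrapT => /negP cn0.
  apply: (hx (fun i => - (c ord0)^-1 * c (lift ord0 i))).
  under eq_bigr do rewrite -scalerA; rewrite -scaler_sumr.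
  move/eqP: c0; rewrite addrC addr_eq0 => /eqP ->.
  by rewrite scaleNr scalerN opprK scalerA mulVf // scale1r.
move: c0; rewrite c00 scale0r add0r => /ind ci i.
by case: (unliftP ord0 i) => [j ->|->].
Qed.

(** A spanning family of least length is independent: a vector with nonzero coefficient in a
    relation could be dropped. *)
Lemma basis_exists (X : normedModType K) : finite_dimensional X ->
  exists n (e : 'I_n -> X), independent e /\
    forall x, exists c : 'I_n -> K, x = \sum_(i < n) c i *: e i.
Proof.
pose P n := `[< exists e : 'I_n -> X,
  forall x, exists c : 'I_n -> K, x = \sum_(i < n) c i *: e i >].
move=> fX; have exP : exists n, P n.
  by case: fX => n he; exists n; apply/asboolP.
case: (ex_minnP exP) => n /asboolP [e he] nmin; exists n, e; split=> // c c0 j.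
apply/eqP; apply: contrapT => /negP cj.
suff /nmin : P n.-1 by case: n j {e he c c0 cj nmin} => [[]//|n _]; rewrite ltnn.
apply/asboolP; exists (fun i => e (lift j i)) => x; have [d xd] := he x.
(* Subtracting [d j / c j] times the relation cancels the coefficient of [e j]. *)
exists (fun i => d (lift j i) - d j / c j * c (lift j i)).
have -> : x = \sum_(i < n) (d i - d j / c j * c i) *: e i.
  under eq_bigr do rewrite scalerBl -scalerA.
  by rewrite sumrB -scaler_sumr c0 scaler0 subr0.
by rewrite (bigD1_ord j) //= divfK // subrr scale0r add0r.
Qed.

End Families.

(** Independence makes the norm of the combination a norm of the coefficients. Complex coefficients
    are encoded as real rows of double length, real parts before imaginary parts. *)
Lemma independent_lower_bound (R : realType) (k : scalar_kind)
    (X : normedModType (scalars R k)) n (e : 'I_n -> X) : independent e ->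
  exists2 d : R, 0 < d & forall (c : 'I_n -> scalars R k) i,
    d * rnorm (c i : (scalars R k)^o) <= rnorm (\sum_(i < n) c i *: e i).
Proof.
case: k X e => X e ind.
  pose N (v : 'rV[R]_n) := rnorm (\sum_(i < n) (v 0 i : scalars R RealScalars) *: e i).
  have ND u v : N (u + v) <= N u + N v.
    rewrite /N; under eq_bigr do rewrite mxE scalerDl.
    by rewrite big_split; exact: rnormD.
  have NZ c u : N (c *: u) = `|c| * N u.
    rewrite /N; under eq_bigr do rewrite mxE -scalerA.
    by rewrite -scaler_sumr rnormZ.
  have N0 v : N v = 0 -> v = 0.
    by move=> /rnorm_eq0 /ind h; apply/rowP => i; rewrite h mxE.
  have [d d0 dN] := rV_norm_lower_bound ND NZ N0; exists d => // c i.
  have := dN (\row_i c i) i; rewrite /N mxE.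
  by under eq_bigr do rewrite mxE.
pose C (v : 'rV[R]_(n + n)) (i : 'I_n) : scalars R ComplexScalars :=
  (v 0 (lshift n i) +i* v 0 (rshift n i))%C.
pose N (v : 'rV[R]_(n + n)) := rnorm (\sum_(i < n) C v i *: e i).
have ND u v : N (u + v) <= N u + N v.
  rewrite /N; have CD i : C (u + v) i = C u i + C v i by rewrite /C !mxE.
  under eq_bigr do rewrite CD scalerDl.
  by rewrite big_split; exact: rnormD.
have NZ c u : N (c *: u) = `|c| * N u.
  rewrite /N; have CZ i : C (c *: u) i = of_real ComplexScalars c * C u i.
    by rewrite /C !mxE /=; apply/eqP; rewrite eq_complex /= !mul0r subr0 addr0 !eqxx.
  under eq_bigr do rewrite CZ -scalerA.
  by rewrite -scaler_sumr rnorm_of_realZ.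
have N0 v : N v = 0 -> v = 0.
  move=> /rnorm_eq0 /ind h; apply/rowP => i; rewrite mxE.
  by case: (split_ordP i) => j ->; have [] := h j.
have [d d0 dN] := rV_norm_lower_bound ND NZ N0.
(* Half of [d], because the modulus of [c i] is bounded by the sum of two coordinates. *)
exists (d / 2) => [|c i]; first by rewrite divr_gt0.
pose v : 'rV[R]_(n + n) := row_mx (\row_i complex.Re (c i)) (\row_i complex.Im (c i)).
have vl j : v 0 (lshift n j) = complex.Re (c j) by rewrite row_mxEl mxE.
have vr j : v 0 (rshift n j) = complex.Im (c j) by rewrite row_mxEr mxE.
have Cv j : C v j = c j by rewrite /C vl vr; case: (c j).
have := dN v (lshift n i); have := dN v (rshift n i); rewrite vl vr /N.
under eq_bigr do rewrite Cv; move=> h1 h2.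
have := @rnorm_le_re_im R ComplexScalars (c i) => h3.
apply: le_trans (ler_wpM2l _ h3) _; first by rewrite divr_ge0 // ltW.
by rewrite /=; lra.
Qed.

(** * Dvoretzky-Rogers vectors in an infinite-dimensional space *)

Section DvoretzkyRogers.
Context {R : realType} {k : scalar_kind} (X : normedModType (scalars R k)).

(** Real combinations of [m + m] independent vectors carry a norm on real rows. The first [m] rows
    of the matrix found there, read as coefficients, give the [y i]. *)
Lemma dvoretzky_rogers m : ~ finite_dimensional X -> exists y : 'I_m -> X,
  (forall i, 16^-1 <= rnorm (y i)) /\
  forall a : 'I_m -> R,
    rnorm (\sum_(i < m) of_real k (a i) *: y i) <= Num.sqrt (\sum_(i < m) a i ^+ 2).
Proof.
move=> /(@independent_exists _ _ _ (m + m))[e ind].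
have [d d0 dN] := independent_lower_bound ind.
pose N (v : 'rV[R]_(m + m)) := rnorm (\sum_i of_real k (v 0 i) *: e i).
have ND u v : N (u + v) <= N u + N v.
  rewrite /N; under eq_bigr do rewrite mxE of_realD scalerDl.
  by rewrite big_split; exact: rnormD.
have NZ c u : N (c *: u) = `|c| * N u.
  rewrite /N; under eq_bigr do rewrite mxE of_realM -scalerA.
  by rewrite -scaler_sumr rnorm_of_realZ.
have Nd : exists2 e, 0 < e & forall (v : 'rV[R]_(m + m)) i, e * `|v 0 i| <= N v.
  exists d => // v i; apply: le_trans (dN (fun i => of_real k (v 0 i)) i).
  by rewrite {1}/rnorm norm_of_real re_of_real.
have [U [hU good]] := dvoretzky_rogers_rows ND NZ Nd.
exists (fun i => \sum_j of_real k (U (lshift m i) j) *: e j); split=> [i|a].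
  have -> : \sum_j of_real k (U (lshift m i) j) *: e j =
      \sum_j of_real k (row (lshift m i) U 0 j) *: e j.
    by apply: eq_bigr => j _; rewrite mxE.
  exact: good (lshift m i) (ltn_ord i).
(* Padding [a] with zeros selects the first [m] rows of [U]. *)
pose v : 'rV[R]_(m + m) := row_mx (\row_i a i) 0.
have vl i : v 0 (lshift m i) = a i by rewrite row_mxEl mxE.
have vr i : v 0 (rshift m i) = 0 by rewrite row_mxEr mxE.
have -> : \sum_(i < m) a i ^+ 2 = \sum_i v 0 i ^+ 2.
  rewrite big_split_ord /= [X in _ = _ + X]big1 => [|i _].
    by rewrite addr0; apply: eq_bigr => i _; rewrite vl.
  by rewrite vr expr0n.
suff -> : rnorm (\sum_(i < m)
    of_real k (a i) *: \sum_j of_real k (U (lshift m i) j) *: e j) = N (v *m U) by exact: hU.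
congr rnorm; under eq_bigr do rewrite scaler_sumr.
rewrite exchange_big /=; apply: eq_bigr => j _.
under eq_bigr do rewrite scalerA -of_realM.
rewrite -scaler_suml -(big_morph _ (@of_realD R k) (@of_real0 R k)).
congr (of_real k _ *: _); rewrite mxE big_split_ord /= [X in _ = _ + X]big1 ?addr0.
  by apply: eq_bigr => i _; rewrite vl.
by move=> i _; rewrite vr mul0r.
Qed.

End DvoretzkyRogers.

(** * Nonnegative series, dyadic blocks and powers *)

Section Series.
Context {R : realType}.

Lemma nneseries_ub (u : nat -> \bar R) M : (forall i, 0 <= u i)%E ->
  (forall n, \sum_(0 <= i < n) u i <= M)%E -> (\sum_(0 <= i <oo) u i <= M)%E.
Proof.
move=> u0 h; apply: lime_le; first by apply: is_cvg_nneseries => n _ _; exact: u0.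
by apply: nearW => n; exact: h.
Qed.

Lemma nneseries_partial_le (u : nat -> \bar R) n : (forall i, 0 <= u i)%E ->
  (\sum_(0 <= i < n) u i <= \sum_(0 <= i <oo) u i)%E.
Proof. by move=> u0; apply: nneseries_lim_ge => i _ _; exact: u0. Qed.

Lemma nneseries_term_le (u : nat -> \bar R) i : (forall i, 0 <= u i)%E ->
  (u i <= \sum_(0 <= i <oo) u i)%E.
Proof.
move=> u0; apply: le_trans (nneseries_partial_le i.+1 u0).
by rewrite big_nat_recr //= leeDr // sume_ge0.
Qed.

Lemma nneseries_ltyP (a : nat -> R) : (forall i, 0 <= a i) ->
  (\sum_(0 <= i <oo) (a i)%:E < +oo)%E <->
  exists M, forall n, \sum_(0 <= i < n) a i <= M.
Proof.
move=> a0; have a0' i : (0 <= (a i)%:E)%E by rewrite lee_fin.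
split=> [h|[M h]]; last first.
  apply: le_lt_trans (ltry M); apply: nneseries_ub => // n.
  by rewrite sumEFin lee_fin.
have fin : (\sum_(0 <= i <oo) (a i)%:E)%E \is a fin_num.
  by rewrite ge0_fin_numE // nneseries_ge0.
exists (fine (\sum_(0 <= i <oo) (a i)%:E)%E) => n.
by rewrite -lee_fin fineK // -sumEFin nneseries_partial_le.
Qed.

(** The blocks from [2 ^ m] up to [2 ^ m.+1] tile the indices from 1 on; index 0 lies in no
    block. *)
Lemma big_dyadic (g : nat -> R) M :
  \sum_(1 <= j < 2 ^ M) g j =
  \sum_(0 <= m < M) \sum_(0 <= i < 2 ^ m) g (2 ^ m + i)%N.
Proof.
elim: M => [|M IH]; first by rewrite expn0 !big_geq.
rewrite big_nat_recr //= -IH (@big_cat_nat _ _ _ (2 ^ M)) ?expn_gt0 //=; last first.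
  by rewrite leq_exp2l.
congr (_ + _); rewrite -{1}[(2 ^ M)%N]add0n big_addn expnS mul2n -addnn addnK.
by apply: eq_bigr => i _; rewrite addnC.
Qed.

Lemma trunc_log_dyadic m i : (i < 2 ^ m)%N -> trunc_log 2 (2 ^ m + i) = m.
Proof.
move=> h; apply: trunc_log_eq => //; rewrite leq_addr /= expnS mul2n -addnn.
by rewrite ltn_add2l.
Qed.

Lemma sum_geometric_le (rho : R) M : 0 <= rho < 1 ->
  \sum_(0 <= m < M) rho ^+ m <= (1 - rho)^-1.
Proof.
case/andP=> r0 r1; have r2 : 0 < 1 - rho by rewrite subr_gt0.
rewrite -[leRHS]mul1r ler_pdivlMr //.
have -> : (\sum_(0 <= m < M) rho ^+ m) * (1 - rho) = 1 - rho ^+ M.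
  elim: M => [|M IH]; first by rewrite big_geq // mul0r expr0 subrr.
  by rewrite big_nat_recr //= mulrDl IH exprS; ring.
by rewrite gerBl exprn_ge0.
Qed.

(** For [t] below [eta] the last term dominates by monotonicity; above it, write the power as [t]
    times the decreasing factor of exponent [th - 1]. Summed over a block, this plays the part of
    Hölder's inequality. *)
Lemma powR_le_affine (th eta t : R) : 0 < th < 1 -> 0 < eta -> 0 <= t ->
  t `^ th <= eta `^ (th - 1) * t + eta `^ th.
Proof.
move=> /andP[th0 th1] eta0 t0; have [te|te] := leP t eta.
  apply: ler_wpDl; first by rewrite mulr_ge0 ?powR_ge0.
  by apply: ge0_ler_powR => //; rewrite ?nnegrE; exact: ltW.
apply: ler_wpDr; first exact: powR_ge0.
rewrite -(mulr_powRB1 t0 th0) mulrC ler_wpM2r // -[th - 1]opprB !powRN.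
rewrite lef_pV2 ?posrE ?powR_gt0 //; last exact: lt_trans te.
by apply: ge0_ler_powR; rewrite ?nnegrE ?subr_ge0 //; exact: ltW.
Qed.

Lemma abs_summableP p (u : nat -> R) : (forall i, 0 <= u i) ->
  abs_summable p u <-> exists M, forall n, \sum_(0 <= i < n) u i `^ p <= M.
Proof. by move=> u0; apply: nneseries_ltyP => i; exact: powR_ge0. Qed.

Lemma abs_summable_le (r s : R) (u : nat -> R) : 0 < r -> r <= s ->
  (forall i, 0 <= u i) -> abs_summable r u -> abs_summable s u.
Proof.
move=> r0 rs u0 /(abs_summableP _ u0)[M hM]; apply/(abs_summableP _ u0).
have uM i : u i `^ r <= M.
  apply: le_trans (hM i.+1); rewrite big_nat_recr //= lerDr.
  by apply: sumr_ge0 => *; exact: powR_ge0.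
have M0 : 0 <= M by apply: le_trans (uM 0%N); exact: powR_ge0.
exists ((M `^ r^-1) `^ (s - r) * M) => n.
apply: (@le_trans _ _ ((M `^ r^-1) `^ (s - r) * \sum_(0 <= i < n) u i `^ r)).
  rewrite mulr_sumr; apply: ler_sum => i _.
  rewrite -{1}[s](subrK r) [leLHS]powRD; last first.
    by rewrite subrK (gt_eqF (lt_le_trans r0 rs)).
  rewrite ler_wpM2r ?powR_ge0 //.
  apply: ge0_ler_powR; rewrite ?nnegrE ?powR_ge0 ?subr_ge0 //.
  rewrite -[leLHS]powRr1 // -(mulfV (lt0r_neq0 r0)) powRrM.
  by apply: ge0_ler_powR; rewrite ?nnegrE ?powR_ge0 ?invr_ge0 //; exact: ltW.
by rewrite ler_wpM2l ?powR_ge0.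
Qed.

End Series.

(** A copy of [g] indexed by its linearity proof, on which the linear structure can be declared. *)
Definition linear_of (K : numFieldType) (X : normedModType K) (g : X -> K^o)
  (_ : linear g) : X -> K^o := g.

HB.instance Definition _ (K : numFieldType) (X : normedModType K) (g : X -> K^o)
  (hg : linear g) := GRing.isLinear.Build K X K^o _ (linear_of hg) hg.

(** * Dual norms and the two inclusions between [lp] and [lA] *)

Section Duals.
Context {R : realType} {k : scalar_kind}.
Local Notation K := (scalars R k).
Implicit Types (X : normedModType K) (s q r : R).

Lemma dual_bounded X (f : dual X) :
  has_sup [set rnorm (f x) | x in [set x : X | rnorm x <= 1]].
Proof.
split; first by exists (rnorm (f 0)), 0; rewrite //= rnorm0.
have /linear_boundedP/pinfty_ex_gt0[M M0 hM] :=
  continuous_linear_bounded 0 (@dual_continuous _ _ f 0).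
exists (re_scalar M) => _ [x /= x1 <-].
apply: ler_re_scalar; apply: le_trans (hM x) _.
rewrite -of_real_rnorm -[leRHS]mulr1 ler_wpM2l ?(ltW M0) //.
have -> : 1 = of_real k 1 :> K by case: (k).
by rewrite ler_of_real.
Qed.

Lemma dual_norm_ge0 X (f : dual X) : 0 <= dual_norm f.
Proof.
apply: le_trans (rnorm_ge0 (f 0)) _; apply: ub_le_sup (dual_bounded f).2 _ _.
by exists 0; rewrite //= rnorm0.
Qed.

Lemma rnorm_dual_le X (f : dual X) (x : X) : rnorm (f x) <= dual_norm f * rnorm x.
Proof.
have [->|x0] := eqVneq x 0; first by rewrite linear0 !rnorm0 mulr0.
have nx : 0 < rnorm x.
  by rewrite lt_neqAle rnorm_ge0 andbT eq_sym; apply: contra_neq x0 => /rnorm_eq0.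
rewrite -ler_pdivrMr //; apply: ub_le_sup (dual_bounded f).2 _ _.
exists (of_real k (rnorm x)^-1 *: x) => /=.
  by rewrite rnorm_of_realZ gtr0_norm ?invr_gt0 // mulVf // gt_eqF.
by rewrite linearZ rnorm_of_realZ gtr0_norm ?invr_gt0 // mulrC.
Qed.

Lemma dual_of_bounded X (g : X -> K^o) (C : R) : linear g ->
  (forall x, rnorm (g x) <= C * rnorm x) -> exists f : dual X, forall x, f x = g x.
Proof.
move=> glin gC.
have cg : continuous (linear_of glin).
  apply: bounded_linear_continuous; apply/linear_boundedP.
  (* Over the complex field only real elements are comparable with those near +oo. *)
  have CR : of_real k C \is Num.real.
    by case: (k) => //=; rewrite ?num_real //; apply/complex_realP; exists C.
  near=> M => x; apply: (@le_trans _ _ (of_real k C * `|x|)).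
    by rewrite -!of_real_rnorm -of_realM ler_of_real.
  by apply: ler_wpM2r => //; near: M; exact: nbhs_pinfty_ge.
by exists (@Dual _ _ (linear_of glin) cg).
Unshelve. all: by end_near. Qed.

Definition weak_sum s X (f : nat -> dual X) (x : X) : \bar R :=
  (\sum_(0 <= i <oo) (rnorm (f i x) `^ s)%:E)%E.

Lemma weak_sum_ge0 s X (f : nat -> dual X) (x : X) : (0 <= weak_sum s f x)%E.
Proof. by apply: nneseries_ge0 => *; rewrite lee_fin powR_ge0. Qed.

Lemma weak_sum_le s X (f : nat -> dual X) (x : X) G : 0 <= s ->
  (forall n, \sum_(0 <= i < n) dual_norm (f i) `^ s <= G) ->
  (weak_sum s f x <= (rnorm x `^ s * G)%:E)%E.
Proof.
move=> s0 hG; apply: nneseries_ub => [i|n]; first by rewrite lee_fin powR_ge0.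
rewrite sumEFin lee_fin.
apply: (@le_trans _ _ (rnorm x `^ s * \sum_(0 <= i < n) dual_norm (f i) `^ s)).
  rewrite mulr_sumr; apply: ler_sum => i _.
  rewrite -powRM ?rnorm_ge0 ?dual_norm_ge0 // mulrC.
  apply: ge0_ler_powR; rewrite ?nnegrE ?rnorm_ge0 ?mulr_ge0 ?rnorm_ge0 ?dual_norm_ge0 //.
  exact: rnorm_dual_le.
by rewrite ler_wpM2l ?powR_ge0.
Qed.

Lemma weak_sumZ s X (f : nat -> dual X) (x : X) (t : R) : 0 <= t ->
  weak_sum s f (of_real k t *: x) = ((t `^ s)%:E * weak_sum s f x)%E.
Proof.
move=> t0; rewrite /weak_sum -nneseriesZl; last by move=> *; rewrite lee_fin powR_ge0.
apply: eq_eseriesr => i _; rewrite linearZ rnorm_of_realZ ger0_norm //.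
by rewrite powRM // rnorm_ge0.
Qed.

Lemma lp_dual_bound s r X (f : nat -> dual X) : 1 <= r -> r <= s -> lp_dual r X f ->
  exists2 G, 0 <= G & forall n, \sum_(0 <= i < n) dual_norm (f i) `^ s <= G.
Proof.
move=> r1 rs fr.
have u0 i : 0 <= dual_norm (f i) by exact: dual_norm_ge0.
have /(abs_summableP _ u0)[G hG] := abs_summable_le (lt_le_trans ltr01 r1) rs u0 fr.
by exists G => //; have := hG 0%N; rewrite big_geq.
Qed.

(** The inner sum at [x j] is at most [G * rnorm (x j)]^ s[; raising to the power]q /
    s[leaves a constant multiple of]rnorm (x j) [^ q]. *)
Lemma lp_sub_lA s q r X : 1 <= s -> 1 <= q -> 1 <= r -> r <= s ->
  lp q X `<=` lA s q r X.
Proof.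
move=> s1 q1 r1 rs x /= xq f /(lp_dual_bound r1 rs)[G G0 hG].
have s0 : 0 < s by exact: lt_le_trans s1.
have q0 : 0 < q by exact: lt_le_trans q1.
have th0 : 0 <= q / s by rewrite divr_ge0 // ltW.
apply: (@le_lt_trans _ _ (\sum_(0 <= j <oo) (G `^ (q / s))%:E * (rnorm (x j) `^ q)%:E)%E).
  apply: lee_nneseries => [j _ _|j _]; first exact: poweR_ge0.
  have := weak_sum_le (x j) (ltW s0) hG; have := weak_sum_ge0 s f (x j).
  rewrite -/(weak_sum s f (x j)); case: (weak_sum s f (x j)) => [t| |] //.
  rewrite !lee_fin => t0 tG.
  have -> : G `^ (q / s) * rnorm (x j) `^ q = (rnorm (x j) `^ s * G) `^ (q / s).
    by rewrite powRM ?powR_ge0 // -powRrM mulrCA divff ?gt_eqF // mulr1 mulrC.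
  by apply: ge0_ler_powR;
    rewrite ?nnegrE ?mulr_ge0 ?powR_ge0 ?invr_ge0 ?(ltW s0) ?(ltW q0).
rewrite nneseriesZl; last by move=> *; rewrite lee_fin powR_ge0.
rewrite lte_mul_pinfty ?lee_fin ?powR_ge0 //.
Qed.

(** Independence makes the chosen coefficients unique, hence linear in [x]; the coordinate bound
    makes them continuous. *)
Lemma coordinate_duals X : finite_dimensional X -> exists n (e : 'I_n -> X)
  (f : 'I_n -> dual X), forall x, x = \sum_(i < n) f i x *: e i.
Proof.
move=> /basis_exists[n [e [ind span]]].
have [c hc] := choice span.
have [d d0 hd] := independent_lower_bound ind.
have clin i : linear (fun x => c x i : K^o).
  move=> a x y; apply/eqP; rewrite -subr_eq0; apply/eqP.
  apply: (ind (fun i => c (a *: x + y) i - (a *: (c x i : K^o) + c y i))).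
  under eq_bigr do rewrite scalerBl scalerDl -scalerA.
  by rewrite sumrB big_split /= -scaler_sumr -!hc subrr.
have cb i x : rnorm (c x i : K^o) <= d^-1 * rnorm x.
  by rewrite mulrC ler_pdivlMr // mulrC {2}[x]hc; exact: hd.
have [f hf] := choice (fun i => dual_of_bounded (clin i) (cb i)).
by exists n, e, f => x; under eq_bigr do rewrite hf.
Qed.

Lemma lA_sub_lp s q r X : 1 <= s -> 1 <= q -> 1 <= r -> finite_dimensional X ->
  lA s q r X `<=` lp q X.
Proof.
move=> s1 q1 r1 /coordinate_duals[n [e [f he]]] x /= xA.
have s0 : 0 < s by exact: lt_le_trans s1.
have q0 : 0 < q by exact: lt_le_trans q1.
have r0 : 0 < r by exact: lt_le_trans r1.
have [z hz] : exists z : dual X, forall x, z x = 0.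
  apply: (@dual_of_bounded _ (fun=> 0) 0) => [a u v|u].
    by rewrite scaler0 addr0.
  by rewrite rnorm0 mul0r.
have nz : dual_norm z = 0.
  apply/eqP; rewrite eq_le dual_norm_ge0 andbT; apply: ge_sup => [|_ [u _ <-]].
    exact: (dual_bounded z).1.
  by rewrite hz rnorm0.
(* The test sequence: the coordinate functionals followed by zeros, thus in [lp_dual r X]. *)
pose g i := if insub i is Some j then f j else z.
have gr : lp_dual r X g.
  apply/(abs_summableP _ (fun i => dual_norm_ge0 (g i))).
  exists (\sum_(0 <= i < n) dual_norm (g i) `^ r) => m.
  apply: (@le_trans _ _ (\sum_(0 <= i < maxn m n) dual_norm (g i) `^ r)).
    rewrite [leRHS](@big_cat_nat _ _ _ m) ?leq_maxl //= lerDl.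
    by apply: sumr_ge0 => *; exact: powR_ge0.
  rewrite (@big_cat_nat _ _ _ n) ?leq_maxr //= gerDl big_nat big1 // => i /andP[ni _].
  by rewrite /g insubF ?nz ?powR0 ?gt_eqF // ltnNge ni.
pose B := 1 + \sum_(i < n) rnorm (e i).
have B0 : 0 < B by rewrite ltr_wpDr // sumr_ge0 // => i _; exact: rnorm_ge0.
have key j : ((rnorm (x j) `^ q)%:E <= (B `^ q)%:E * weak_sum s g (x j) `^ (q / s))%E.
  have w1 (i : 'I_n) : ((rnorm (f i (x j)) `^ s)%:E <= weak_sum s g (x j))%E.
    have -> : f i = g i by rewrite /g valK.
    apply: (@nneseries_term_le _ (fun i => (rnorm (g i (x j)) `^ s)%:E)) => l.
    by rewrite lee_fin powR_ge0.
  have := weak_sum_ge0 s g (x j).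
  case: (weak_sum s g (x j)) w1 => [w| |] // w1; last first.
    (* An infinite inner sum makes the right-hand side infinite, since [B] is positive. *)
    rewrite poweRyr; last by rewrite mulf_neq0 ?invr_eq0 ?gt_eqF.
    by rewrite gt0_muley ?leey // lte_fin powR_gt0.
  rewrite lee_fin => w0; rewrite poweR_EFin -EFinM lee_fin.
  have -> : B `^ q * w `^ (q / s) = (B * w `^ s^-1) `^ q.
    by rewrite powRM ?powR_ge0 ?ltW // -powRrM [q / s]mulrC.
  apply: ge0_ler_powR;
    rewrite ?nnegrE ?rnorm_ge0 ?mulr_ge0 ?powR_ge0 ?(ltW B0) ?(ltW q0) //.
  rewrite {1}(he (x j)); apply: le_trans (rnorm_sum _ _) _.
  rewrite mulrDl mul1r ler_wpDl ?powR_ge0 // mulr_suml ler_sum // => i _.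
  rewrite rnormZ mulrC ler_wpM2l ?rnorm_ge0 //.
  have := w1 i; rewrite lee_fin => wi.
  rewrite -[leLHS]powRr1 ?rnorm_ge0 // -(mulfV (lt0r_neq0 s0)) powRrM.
  by apply: ge0_ler_powR; rewrite ?nnegrE ?powR_ge0 ?invr_ge0 ?(ltW s0).
apply: (@le_lt_trans _ _
    (\sum_(0 <= j <oo) (B `^ q)%:E * weak_sum s g (x j) `^ (q / s))%E).
  by apply: lee_nneseries => [j _ _|j _]; rewrite ?lee_fin ?powR_ge0 ?key.
rewrite nneseriesZl; last by move=> *; exact: poweR_ge0.
rewrite lte_mul_pinfty ?lee_fin ?powR_ge0 //.
exact: xA g gr.
Qed.

End Duals.

(** * Functionals evaluated on Dvoretzky-Rogers vectors *)

Section WeaklyTwoSummable.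
Context {R : realType} {k : scalar_kind} {X : normedModType (scalars R k)}.
Local Notation K := (scalars R k).

Definition weakly2_contractive m (y : nat -> X) := forall a : nat -> R,
  rnorm (\sum_(0 <= i < m) of_real k (a i) *: y i) <=
    Num.sqrt (\sum_(0 <= i < m) a i ^+ 2).

Lemma dvoretzky_rogers_seq m : ~ finite_dimensional X -> exists y : nat -> X,
  (forall i, (i < m)%N -> 16^-1 <= rnorm (y i)) /\ weakly2_contractive m y.
Proof.
move=> /(@dvoretzky_rogers _ _ _ m)[y [y1 y2]].
exists (fun i => if insub i is Some j then y j else 0); split=> [i im|a].
  by rewrite insubT.
rewrite !big_mkord; under eq_bigr do rewrite valK; exact: y2.
Qed.

(** [phi] stands for the real or the imaginary part. With the signs of [phi (f (y i))] as
    coefficients, the sum becomes one value of [phi] after [f], at a vector of norm at most the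
    square root of [m]. *)
Lemma sum_functional_le (phi : K -> R) m (y : nat -> X) (f : dual X) :
  (forall a b, phi (a + b) = phi a + phi b) -> phi 0 = 0 ->
  (forall x a, phi (of_real k x * a) = x * phi a) ->
  (forall a, `|phi a| <= rnorm (a : K^o)) -> weakly2_contractive m y ->
  \sum_(0 <= i < m) `|phi (f (y i))| <= Num.sqrt m%:R * dual_norm f.
Proof.
move=> phiD phi0 phiM phile hy.
pose a i := Num.sg (phi (f (y i))).
have -> : \sum_(0 <= i < m) `|phi (f (y i))| =
    phi (f (\sum_(0 <= i < m) of_real k (a i) *: y i)).
  rewrite linear_sum (big_morph _ phiD phi0); apply: eq_bigr => i _.
  by rewrite linearZ phiM /a -normrEsg.
apply: le_trans (ler_norm _) _; apply: le_trans (phile _) _.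
apply: le_trans (rnorm_dual_le _ _) _.
rewrite mulrC; apply: ler_wpM2r; first exact: dual_norm_ge0.
apply: le_trans (hy a) _; apply: ler_wsqrtr.
have -> : m%:R = \sum_(0 <= i < m) 1 :> R by rewrite sumr_const_nat subn0.
apply: ler_sum => i _.
by rewrite /a sqr_sg; case: (_ != 0).
Qed.

Lemma sum_rnorm_dual_le m (y : nat -> X) (f : dual X) : weakly2_contractive m y ->
  \sum_(0 <= i < m) rnorm (f (y i)) <= 2 * Num.sqrt m%:R * dual_norm f.
Proof.
move=> hy; have h1 := sum_functional_le f (@re_scalarD _ _) re_scalar0
  (@re_scalar_of_realM _ _) (@normr_re_le_rnorm _ _) hy.
have h2 := sum_functional_le f (@im_scalarD _ _) im_scalar0
  (@im_scalar_of_realM _ _) (@normr_im_le_rnorm _ _) hy.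
apply: le_trans (ler_sum _ (fun i _ => rnorm_le_re_im (f (y i)))) _.
by rewrite big_split /=; lra.
Qed.

(** All but one of the [s] factors of [rnorm (f (y i))] are bounded by [dual_norm f]; the remaining
    first powers are summed by the previous estimate. *)
Lemma sum_powR_dual_le m (y : nat -> X) (f : dual X) s : 1 <= s ->
  weakly2_contractive m y ->
  \sum_(0 <= i < m) rnorm (f (y i)) `^ s <= 2 * Num.sqrt m%:R * dual_norm f `^ s.
Proof.
move=> s1 hy; have s0 : 0 < s by exact: lt_le_trans s1.
have y1 i : (i < m)%N -> rnorm (y i) <= 1.
  (* Testing on a coordinate vector shows that each [y i] has norm at most 1. *)
  move=> im; have := hy (fun j => (j == i)%:R).
  rewrite !big_mkord (bigD1 (Ordinal im)) //= big1 => [|j]; last first.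
    by rewrite -val_eqE /= => /negbTE ->; rewrite of_real0 scale0r.
  rewrite [X in _ <= Num.sqrt X -> _](bigD1 (Ordinal im)) //= big1 => [|j]; last first.
    by rewrite -val_eqE /= => /negbTE ->; rewrite expr0n.
  by rewrite eqxx !addr0 expr1n sqrtr1 rnorm_of_realZ normr1 mul1r.
rewrite -[_ `^ s](mulr_powRB1 (dual_norm_ge0 f) s0) mulrA.
apply: (@le_trans _ _ ((\sum_(0 <= i < m) rnorm (f (y i))) * dual_norm f `^ (s - 1))).
  rewrite mulr_suml; apply: ler_sum_nat => i /andP[_ im].
  rewrite -(mulr_powRB1 (rnorm_ge0 _) s0) ler_wpM2l ?rnorm_ge0 //.
  apply: ge0_ler_powR; rewrite ?nnegrE ?subr_ge0 ?rnorm_ge0 ?dual_norm_ge0 //.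
  apply: le_trans (rnorm_dual_le _ _) _.
  by rewrite -[leRHS]mulr1 ler_wpM2l ?dual_norm_ge0 ?y1.
by rewrite ler_wpM2r ?powR_ge0 ?sum_rnorm_dual_le.
Qed.

Lemma sum_weak_sum_le m (y : nat -> X) (f : nat -> dual X) s G : 1 <= s ->
  (forall n, \sum_(0 <= i < n) dual_norm (f i) `^ s <= G) -> weakly2_contractive m y ->
  (\sum_(0 <= j < m) weak_sum s f (y j) <= (2 * Num.sqrt m%:R * G)%:E)%E.
Proof.
move=> s1 hG hy; rewrite /weak_sum -nneseries_sum_nat; last first.
  by move=> *; rewrite lee_fin powR_ge0.
apply: nneseries_ub => [i|n]; first by apply: sume_ge0 => *; rewrite lee_fin powR_ge0.
under eq_bigr do rewrite sumEFin; rewrite sumEFin lee_fin.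
apply: (@le_trans _ _ (\sum_(0 <= i < n) 2 * Num.sqrt m%:R * dual_norm (f i) `^ s)).
  by apply: ler_sum => i _; exact: sum_powR_dual_le.
by rewrite -mulr_sumr ler_wpM2l // mulr_ge0 // sqrtr_ge0.
Qed.

End WeaklyTwoSummable.

(** * The dyadic sequence separating [lA] from [lp] *)

Section InfiniteDimensional.
Context {R : realType} {k : scalar_kind} {X : normedModType (scalars R k)}.
Context (s q : R) (y : nat -> nat -> X).
Context (s1 : 1 <= s) (q1 : 1 <= q) (qs : q < s).
Context (ylow : forall m i, (i < 2 ^ m)%N -> 16^-1 <= rnorm (y m i)).
Context (ycontr : forall m, weakly2_contractive (2 ^ m) (y m)).

(** Block [m] sits at the indices from [2 ^ m] to [2 ^ m.+1 - 1]. The term at 0 belongs to no block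
    and is treated apart. *)
Let dyadic_seq (j : nat) : X :=
  let m := trunc_log 2 j in
  of_real k (((2 ^ m)%:R : R) `^ (- q^-1)) *: y m (j - 2 ^ m).

Let q0 : 0 < q. Proof. exact: lt_le_trans q1. Qed.
Let s0 : 0 < s. Proof. exact: lt_le_trans s1. Qed.

Let dyadic_seqE m i : (i < 2 ^ m)%N ->
  dyadic_seq (2 ^ m + i) = of_real k (((2 ^ m)%:R : R) `^ (- q^-1)) *: y m i.
Proof. by move=> h; rewrite /dyadic_seq trunc_log_dyadic // addKn. Qed.

Let powR_inv (a : R) : 0 <= a -> (a `^ (- q^-1)) `^ q = a^-1.
Proof. by move=> a0; rewrite -powRrM mulNr mulVf ?gt_eqF // powR_inv1. Qed.

(** Each block contributes at least [c], the [q]-th power of 1/16, so [n] blocks contribute at least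
    [n%:R * c], which is unbounded. *)
Lemma dyadic_seq_notin_lp : ~ lp q X dyadic_seq.
Proof.
move=> /(abs_summableP _ (fun j => rnorm_ge0 (dyadic_seq j)))[M hM].
pose c : R := 16^-1 `^ q; have c0 : 0 < c by rewrite powR_gt0 ?invr_gt0.
have low n : n%:R * c <= M.
  apply: le_trans (hM (2 ^ n)%N); rewrite big_ltn ?expn_gt0 // ler_wpDl ?powR_ge0 //.
  have -> : n%:R * c = \sum_(0 <= m < n) c by rewrite sumr_const_nat subn0 mulr_natl.
  rewrite big_dyadic; apply: ler_sum => m _.
  have -> : c = \sum_(0 <= i < 2 ^ m) ((2 ^ m)%:R)^-1 * c.
    by rewrite sumr_const_nat subn0 -[RHS]mulr_natl mulrA divff ?mul1r //
      pnatr_eq0 -lt0n expn_gt0.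
  apply: ler_sum_nat => i /andP[_ im]; rewrite dyadic_seqE // rnorm_of_realZ.
  rewrite ger0_norm ?powR_ge0 // powRM ?powR_ge0 ?rnorm_ge0 // powR_inv //.
  rewrite ler_wpM2l ?invr_ge0 //.
  apply: ge0_ler_powR; rewrite ?nnegrE ?rnorm_ge0 ?invr_ge0 //.
    exact: ltW.
  exact: ylow.
have M0 : 0 <= M / c by rewrite divr_ge0 ?(ltW c0) // (le_trans _ (low 0%N)) // mul0r.
have := archi_boundP M0; rewrite ltr_pdivrMr // => h.
by have := lt_le_trans h (low _); rewrite ltxx.
Qed.

Let th := q / s.
Let th01 : 0 < th < 1.
Proof. by rewrite divr_gt0 //= ltr_pdivrMr // mul1r. Qed.
(** The geometric rate at which the contributions of the blocks to the [lA] sum decay. *)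
Let rho := ((Num.sqrt 2)^-1 : R) `^ th.

Let rho01 : 0 <= rho < 1.
Proof.
rewrite powR_ge0 /=; have /andP[t0 _] := th01.
have r2 : 1 < Num.sqrt 2 :> R by rewrite -[ltLHS]sqrtr1 ltr_sqrt // ltr1n.
rewrite /rho -[ltRHS](congr1 (@^~ th) (@powR1 R)).
apply: gt0_ltr_powR; rewrite ?nnegrE ?invr_ge0 ?sqrtr_ge0 //.
by rewrite invf_lt1 // (lt_trans ltr01).
Qed.

Section Block.
Context (f : nat -> dual X) (G : R) (G0 : 0 <= G).
Context (hG : forall n, \sum_(0 <= i < n) dual_norm (f i) `^ s <= G).

Let w (x : X) := fine (weak_sum s f x).

Let wE x : weak_sum s f x = (w x)%:E.
Proof.
rewrite fineK // ge0_fin_numE ?weak_sum_ge0 //.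
by apply: le_lt_trans (weak_sum_le x (ltW s0) hG) _; exact: ltry.
Qed.

Let w_ge0 x : 0 <= w x.
Proof. by rewrite -lee_fin -wE weak_sum_ge0. Qed.

Lemma dyadic_block_le m :
  \sum_(0 <= i < 2 ^ m) w (dyadic_seq (2 ^ m + i)) `^ th <= (2 * G + 1) * rho ^+ m.
Proof.
have /andP[t0 t1] := th01.
pose h : R := Num.sqrt 2 ^+ m.
have h0 : 0 < h by rewrite exprn_gt0 // sqrtr_gt0.
have hh : (2 ^ m)%:R = h * h by rewrite natrX -expr2 -exprM mulnC exprM sqr_sqrtr.
have hs : Num.sqrt (2 ^ m)%:R = h by rewrite hh -expr2 sqrtr_sqr gtr0_norm.
have e0 : 0 < h^-1 by rewrite invr_gt0.
have rhoE : rho ^+ m = h^-1 `^ th.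
  have e1 : 0 <= (Num.sqrt 2 : R)^-1 by rewrite invr_ge0 sqrtr_ge0.
  by rewrite /h -exprVn -(powR_mulrn m e1) powRAC powR_mulrn ?powR_ge0.
have sw : \sum_(0 <= i < 2 ^ m) w (y m i) <= 2 * h * G.
  rewrite -lee_fin -sumEFin -hs; apply: le_trans (sum_weak_sum_le s1 hG (ycontr m)).
  by under [leRHS]eq_bigr do rewrite wE.
apply: (@le_trans _ _ (\sum_(0 <= i < 2 ^ m)
    (h * h)^-1 * (h^-1 `^ (th - 1) * w (y m i) + h^-1 `^ th))).
  apply: ler_sum_nat => i /andP[_ im]; rewrite dyadic_seqE //.
  rewrite /w weak_sumZ ?powR_ge0 // wE -EFinM /= powRM ?powR_ge0 // -[_ `^ s `^ th]powRrM.
  have -> : s * th = q by rewrite /th mulrCA divff ?mulr1 // gt_eqF.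
  rewrite powR_inv // hh ler_wpM2l ?invr_ge0 ?mulr_ge0 ?(ltW h0) //.
  exact: powR_le_affine.
rewrite -mulr_sumr big_split /= -mulr_sumr rhoE.
have -> : \sum_(0 <= i < 2 ^ m) h^-1 `^ th = h * h * h^-1 `^ th.
  by rewrite sumr_const_nat subn0 -hh mulr_natl.
have pE : h^-1 `^ (th - 1) = h * h^-1 `^ th.
  by rewrite -(mulr_powRB1 (ltW e0) t0) mulrA divff ?mul1r // gt_eqF.
rewrite mulrC ler_pdivrMr ?mulr_gt0 // pE.
apply: (@le_trans _ _ (h * h^-1 `^ th * (2 * h * G) + h * h * h^-1 `^ th)).
  by rewrite lerD2r ler_wpM2l // mulr_ge0 ?powR_ge0 // ltW.
by rewrite le_eqVlt; apply/orP; left; apply/eqP; ring.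
Qed.

Lemma dyadic_weak_sum_lt :
  (\sum_(0 <= j <oo) weak_sum s f (dyadic_seq j) `^ th < +oo)%E.
Proof.
under eq_eseriesr do rewrite wE poweR_EFin.
apply/nneseries_ltyP => [j|]; first exact: powR_ge0.
(* The term at 0 plus the geometric series of the block bounds. *)
exists (w (dyadic_seq 0) `^ th + (2 * G + 1) * (1 - rho)^-1) => n.
apply: (@le_trans _ _ (\sum_(0 <= j < 2 ^ n) w (dyadic_seq j) `^ th)).
  rewrite [leRHS](@big_cat_nat _ _ _ n) ?(ltnW (ltn_expl _ _)) //= lerDl.
  by apply: sumr_ge0 => *; exact: powR_ge0.
rewrite big_ltn ?expn_gt0 // lerD2l big_dyadic.
apply: (@le_trans _ _ (\sum_(0 <= m < n) (2 * G + 1) * rho ^+ m)).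
  by apply: ler_sum => m _; exact: dyadic_block_le.
rewrite -mulr_sumr ler_wpM2l ?sum_geometric_le //.
by rewrite addr_ge0 // mulr_ge0.
Qed.

End Block.

Lemma dyadic_seq_in_lA r : 1 <= r -> r <= s -> lA s q r X dyadic_seq.
Proof.
move=> r1 rs f /(lp_dual_bound r1 rs)[G G0 hG]; exact: dyadic_weak_sum_lt G0 hG.
Qed.

End InfiniteDimensional.

Theorem theorem2p8 (R : realType) (k : scalar_kind)
    (X : completeNormedModType (scalars R k)) (s q r : R)
    (hs : 1 <= s) (hq : 1 <= q) (hr : 1 <= r) (hqs : q < s) (hrs : r <= s) :
  finite_dimensional X <-> lA s q r X = lp q X.
Proof.
split=> [fX|eqX].
  by apply/seteqP; split; [exact: lA_sub_lp | exact: lp_sub_lA].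
apply: contrapT => infX.
(* One Dvoretzky-Rogers family per block; their concatenation would lie in [lA], hence by the
   assumed equality in [lp]. *)
have [y hy] := choice (fun m => dvoretzky_rogers_seq (2 ^ m) infX).
apply: (dyadic_seq_notin_lp hq (fun m => (hy m).1)).
rewrite -eqX; exact: dyadic_seq_in_lA (fun m => (hy m).2) _ hr hrs.
Qed.
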